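(* Let $n\ge 1$ be an integer, let $\mathcal{N}_n(x)$ be the (monic) reduced Narayana polynomial of degree $n-1$, and let $$\tilde{\mathcal{N}}_n(x)=\frac{\mathcal{N}_{n+1}(x)-\rho_n\mathcal{N}_n(x)}{x-1},\qquad \rho_n=\frac{\mathcal{N}_{n+1}(1)}{\mathcal{N}_n(1)},$$ which is a polynomial of degree $n-1$. Then $\tilde{\mathcal{N}}_n(x)\prec\mathcal{N}_n(x)$.
   Context: Narayana numbers: $c_{n,k}=\frac1n\binom{n}{k}\binom{n}{k-1}$ for $1\le k\le n$. The reduced Narayana polynomial is $\mathcal{N}_n(x)=\sum_{j=0}^{n-1}c_{n,j+1}x^j$ (so $x\mathcal{N}_n(x)$ is the usual Narayana polynomial). Notation $\prec$: for real polynomials $f,g$ of the same degree $m$, $f\prec g$ means that all zeros of $f$ and $g$ are real and distinct and, writing them in ascending order as $x_1<\dots<x_m$ (for $f$) and $y_1<\dots<y_m$ (for $g$), one has $x_1<y_1<x_2<y_2<\cdots<x_m<y_m$ (vacuous if $m=0$). *)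

(* Defs.v *)
From mathcomp Require Import all_boot all_order all_algebra.
From mathcomp Require Import reals.

Set Implicit Arguments.
Unset Strict Implicit.
Unset Printing Implicit Defensive.

Import Order.TTheory GRing.Theory Num.Theory.

Local Open Scope ring_scope.

Definition narayana_number (R : realType) (n k : nat) : R :=
  n%:R^-1 * 'C(n, k)%:R * 'C(n, k.-1)%:R.

Definition narayana_poly (R : realType) (n : nat) : {poly R} :=
  \poly_(j < n) narayana_number R n j.+1.

Definition narayana_ratio (R : realType) (n : nat) : R :=
  (narayana_poly R n.+1).[1] / (narayana_poly R n).[1].

Definition narayana_numerator (R : realType) (n : nat) : {poly R} :=
  narayana_poly R n.+1 - narayana_ratio R n *: narayana_poly R n.

(* [%/] is Euclidean division, so this is the quotient of the numerator by
   x - 1 only when x - 1 divides it. *)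
Definition narayana_tilde (R : realType) (n : nat) : {poly R} :=
  narayana_numerator R n %/ ('X - 1%:P).

(* The factorization is over R and accounts for the whole degree, so [x] lists
   all the complex zeros of [f]: they are real, simple and in ascending order. *)
Definition real_simple_zeros (R : realType) (m : nat) (f : {poly R})
    (x : m.-tuple R) : Prop :=
  [/\ f != 0,
      f = lead_coef f *: \prod_(a <- x) ('X - a%:P)
    & sorted <%R x].

(* x_1 < y_1 < x_2 < y_2 < ... < x_m < y_m, indexed from 0. *)
Definition interlaced (R : realType) (m : nat) (x y : m.-tuple R) : Prop :=
  (forall i : 'I_m, tnth x i < tnth y i) /\
  (forall i j : 'I_m, j = i.+1 :> nat -> tnth y i < tnth x j).

(* The common length [m] of the two tuples of zeros is the common degree. *)
Definition prec (R : realType) (f g : {poly R}) : Prop :=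
  exists (m : nat) (x y : m.-tuple R),
    [/\ real_simple_zeros f x, real_simple_zeros g y & interlaced x y].

(* Main.v *)
(* The polynomials satisfy
     (n+3) N_(n+2) = (2n+3) (1+x) N_(n+1) - n (1-x)^2 N_n,
   so N_(n+2) and N_n have opposite signs at each zero of N_(n+1). By induction
   the zeros of N_n are real, simple and negative, and N_(n+1) alternates in sign
   along them. At a zero y of N_n the value of the quotient in the theorem is
   N_(n+1)(y) / (y - 1) with y - 1 < 0, so the quotient alternates too, and
   comparing with its sign at -oo places exactly one of its zeros before each
   zero of N_n. *)

Require Import Defs.
From mathcomp Require Import all_boot all_order all_algebra.
From mathcomp Require Import reals.
From mathcomp Require Import polyrcf ring lra.

Import Order.TTheory GRing.Theory Num.Theory.

Local Open Scope ring_scope.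

Lemma coef_narayana_poly (R : realType) (n k : nat) :
  (narayana_poly R n)`_k = narayana_number R n k.+1.
Proof.
rewrite coef_poly; case: ltnP => // n_le_k.
by rewrite /narayana_number bin_small // mulr0 mul0r.
Qed.

(** The subtraction is taken in the field, so no bound on [k] is needed: for [k] above [n] both
    binomial coefficients vanish. *)
Lemma natr_bin_left (R : numFieldType) (n k : nat) :
  'C(n, k.+1)%:R = (n%:R - k%:R) / (k%:R + 1) * 'C(n, k)%:R :> R.
Proof.
have kS_neq0 : k%:R + 1 != 0 :> R by rewrite natr1 pnatr_eq0.
apply: (mulfI kS_neq0); rewrite mulrA mulrCA divff // mulr1 natr1 -natrM.
rewrite mul_bin_left natrM; case: (leqP k n) => [k_le_n|n_lt_k].
  by rewrite natrB.
by rewrite (bin_small n_lt_k) !mulr0.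
Qed.

(** Coefficientwise, Pascal's rule and [natr_bin_left] reduce every binomial to a rational multiple
    of a single one, leaving an identity of rational functions. Degrees 0 and 1 are apart because 'X
    and 'X^2 shift the index. *)
Lemma narayana_rec (R : realType) (n : nat) : (0 < n)%N ->
  (n%:R + 3) *: narayana_poly R n.+2 =
  (2 * n%:R + 3) *: ((1 + 'X) * narayana_poly R n.+1)
  - n%:R *: ((1 - 'X) ^+ 2 * narayana_poly R n).
Proof.
rewrite -(ltr0n R) => n_gt0.
have -> : (1 - 'X) ^+ 2 = 1 - 'X *+ 2 + 'X^2 :> {poly R} by ring.
apply/polyP => k; rewrite !mulrDl !mulNr mulrnAl !mul1r.
rewrite !(coefB, coefD, coefZ, coefMn, coefN, coefXM, coefXnM).
rewrite !coef_narayana_poly /narayana_number.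
case: k => [|[|j]] /=.
- rewrite !bin0 !bin1 -!natr1.
  by field; do ?[apply/andP; split]; apply: lt0r_neq0; lra.
- rewrite !binS !bin0 !natrD !natr_bin_left bin0 -!natr1.
  by field; do ?[apply/andP; split]; apply: lt0r_neq0; lra.
have j_ge0 : 0 <= j%:R :> R by exact: ler0n.
rewrite subn2 /= !binS !natrD !natr_bin_left -!natr1.
by field; do ?[apply/andP; split]; apply: lt0r_neq0; lra.
Qed.

Lemma size_narayana_poly (R : realType) (n : nat) :
  size (narayana_poly R n.+1) = n.+1.
Proof.
rewrite size_poly_eq // /narayana_number binn binSn mulr1 mulVf ?oner_eq0 //.
by rewrite pnatr_eq0.
Qed.

Lemma lead_coef_narayana_poly (R : realType) (n : nat) :
  lead_coef (narayana_poly R n.+1) = 1.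
Proof.
rewrite lead_coefE size_narayana_poly coef_narayana_poly /narayana_number.
by rewrite binn binSn mulr1 mulVf // pnatr_eq0.
Qed.

Lemma horner0_narayana_poly (R : realType) (n : nat) :
  (narayana_poly R n.+1).[0] = 1.
Proof.
rewrite horner_coef0 coef_narayana_poly /narayana_number bin0 bin1 mulr1.
by rewrite mulVf // pnatr_eq0.
Qed.

Lemma poly_sign_minfty (R : rcfType) (f : {poly R}) (b : R) :
  0 < lead_coef f -> exists2 a, a < b & 0 < (-1) ^+ (size f).-1 * f.[a].
Proof.
move=> f_gt0; pose g := (-1) ^+ (size f).-1 *: (f \Po - 'X).
have g_gt0 : 0 < lead_coef g.
  rewrite lead_coefZ lead_coef_comp ?size_polyN ?size_polyX //.
  by rewrite lead_coefN lead_coefX mulrCA -expr2 sqrr_sign mulr1.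
have [c gc] := poly_pinfty_gt_lc g_gt0.
(* The reflected polynomial [g] is positive from [c] on; [1 - b] forces the point strictly below
   [b]. *)
exists (- Num.max c (1 - b)).
  by rewrite ltrNl lt_max; apply/orP; right; rewrite -subr_gt0; lra.
have := gc (Num.max c (1 - b)); rewrite le_max lexx => /(_ isT).
rewrite /g hornerZ horner_comp hornerN hornerX.
exact: lt_le_trans.
Qed.

(** Put a point near -oo in front of [y]: [f] changes sign on each of the [m] consecutive gaps, and
    the [m] zeros so found exhaust its degree. *)
Lemma interlaced_zeros (R : realType) (m : nat) (f : {poly R})
    (y : m.-tuple R) :
  size f = m.+1 -> 0 < lead_coef f -> sorted <%R y ->
  (forall i : 'I_m, 0 < (-1) ^+ (m - i.+1) * f.[tnth y i]) ->
  exists2 x : m.-tuple R, real_simple_zeros f x & interlaced x y.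
Proof.
move=> size_f f_gt0 y_sorted f_alt.
have [a a_lt fa] := poly_sign_minfty _ f (nth 0 y 0) f_gt0.
pose p := a :: y.
have p_sorted : sorted <%R p.
  by rewrite /p; case: (tval y) a_lt y_sorted => //= b s -> ->.
have p_alt i : (i <= m)%N -> 0 < (-1) ^+ (m - i) * f.[nth 0 p i].
  case: i => [_|i i_lt] /=; first by rewrite subn0; rewrite size_f in fa.
  by have := f_alt (Ordinal i_lt); rewrite (tnth_nth 0).
have p_lt i j : (i < j <= m)%N -> nth 0 p i < nth 0 p j.
  case/andP=> ij jm; apply: sorted_ltn_nth => //; first exact: lt_trans.
    by rewrite inE /= size_tuple ltnS (leq_trans (ltnW ij)).
  by rewrite inE /= size_tuple ltnS.
have zero i : exists x, [/\ nth 0 p (i : 'I_m) < x, x < tnth y i & root f x].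
  have := @poly_ivtoo _ f (nth 0 p i) (nth 0 p i.+1).
  case=> [||x /andP[]].
  - by rewrite ltW // p_lt // ltnSn /=.
  (* The exponents [m - i] and [m - i.+1] have an odd sum, so the two values of [f] have a negative
     product. *)
  - have := mulr_gt0 (p_alt i (ltnW (ltn_ord i))) (p_alt _ (ltn_ord i)).
    rewrite mulrACA -exprD -[in X in X -> _](subnSK (ltn_ord i)) addSn exprS.
    by rewrite -signr_odd oddD addbb expr0 mulr1 mulN1r oppr_gt0.
  by exists x; rewrite (tnth_nth 0); split.
have {zero} [x x_zero] := fin_all_exists zero.
have xy : interlaced [tuple x i | i < m] y.
  split=> [i|i j ij]; rewrite tnth_mktuple; first by have [_ xy _] := x_zero i.
  by have [yx _ _] := x_zero j; rewrite ij /= in yx; rewrite (tnth_nth 0).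
exists [tuple x i | i < m] => //.
have x_sorted : sorted <%R [tuple x i | i < m].
  apply/(sortedP 0) => i; rewrite size_tuple => iSm.
  have im := ltnW iSm.
  rewrite -(tnth_nth 0 _ (Ordinal im)) -(tnth_nth 0 _ (Ordinal iSm)).
  by apply: lt_trans (xy.1 _) (xy.2 _ _ _).
split=> //; first by rewrite -lead_coef_eq0 gt_eqF.
apply: all_roots_prod_XsubC; rewrite ?size_tuple //.
- by apply/allP => _ /mapP[i _ ->]; have [_ _ xi] := x_zero i.
- by rewrite uniq_rootsE lt_sorted_uniq.
Qed.

(** Spreads the sign over the linear factors of a split polynomial, one factor -1 for each index
    from [i] on. *)
Lemma signr_prod (R : pzRingType) (m i : nat) :
  (-1) ^+ (m - i) = \prod_(j < m) (-1) ^+ (i <= j)%N :> R.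
Proof.
elim: m => [|m IHm]; first by rewrite big_ord0.
rewrite big_ord_recr /= -IHm; case: leqP => [i_le|lt_i].
  by rewrite subSn // exprSr.
by rewrite mulr1 (eqP lt_i) (eqP (ltnW lt_i)).
Qed.

Lemma real_simple_zeros_root (R : realType) (m : nat) (f : {poly R})
    (x : m.-tuple R) (i : 'I_m) :
  real_simple_zeros f x -> root f (tnth x i).
Proof.
move=> [f_neq0 -> _]; rewrite rootZ ?lead_coef_eq0 //.
by rewrite root_prod_XsubC mem_tnth.
Qed.

Lemma sign_between_zeros (R : realType) (m i : nat) (f : {poly R})
    (y : m.-tuple R) (c : R) :
  0 < lead_coef f -> real_simple_zeros f y ->
  (forall j : 'I_m, (j < i)%N -> tnth y j < c) ->
  (forall j : 'I_m, (i <= j)%N -> c < tnth y j) ->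
  0 < (-1) ^+ (m - i) * f.[c].
Proof.
move=> f_gt0 [_ -> _] below above; rewrite hornerZ mulrCA.
rewrite pmulr_rgt0 //.
rewrite horner_prod big_tuple signr_prod -big_split /=.
apply: prodr_gt0 => j _; rewrite hornerXsubC; case: leqP => [/above|/below].
  by rewrite mulN1r opprB subr_gt0.
by rewrite mul1r subr_gt0.
Qed.

(** The alternation clause makes the induction run: it is what locates the zeros of the next
    polynomial. *)
Lemma narayana_zeros (R : realType) (n : nat) :
  exists y : n.-tuple R,
    [/\ real_simple_zeros (narayana_poly R n.+1) y,
        forall i, tnth y i < 0
      & forall i : 'I_n,
          0 < (-1) ^+ (n - i) * (narayana_poly R n.+2).[tnth y i]].
Proof.
elim: n => [|n [y [y_zero y_lt0 y_alt]]].
  exists [tuple]; split; [split|by case|by case] => //.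
    by rewrite -lead_coef_eq0 lead_coef_narayana_poly oner_eq0.
  rewrite lead_coef_narayana_poly scale1r big_nil.
  rewrite (size1_polyC (eq_leq (size_narayana_poly R 0))) -horner_coef0.
  by rewrite horner0_narayana_poly.
(* The extra point 0, where the value is 1, supplies the missing last sign and bounds the new zeros
   above. *)
have [||||z z_zero zy0] := @interlaced_zeros R n.+1 (narayana_poly R n.+2)
  [tuple of rcons y 0].
- by rewrite size_narayana_poly.
- by rewrite lead_coef_narayana_poly ltr01.
- have [_ _ y_sorted] := y_zero.
  rewrite /= (sorted_pairwise lt_trans) pairwise_rcons.
  rewrite -(sorted_pairwise lt_trans) y_sorted andbT.
  by apply/allP => _ /tnthP[i ->].
- move=> i; rewrite (tnth_nth 0) /= nth_rcons size_tuple subSS.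
  have := ltn_ord i; rewrite ltnS leq_eqVlt => /orP[/eqP-> | lt_in].
    by rewrite ltnn eqxx subnn mul1r horner0_narayana_poly ltr01.
  rewrite lt_in -[nth 0 y i](tnth_nth 0 y (Ordinal lt_in)).
  exact: (y_alt (Ordinal lt_in)).
have z_lt0 i : tnth z i < 0.
  apply: lt_le_trans (zy0.1 i) _; rewrite (tnth_nth 0) /= nth_rcons size_tuple.
  case: ltnP => [lt_in|_]; last by case: eqP.
  by rewrite -[nth 0 y i](tnth_nth 0 y (Ordinal lt_in)) ltW.
exists z; split=> // i.
have z_le (j k : 'I_n.+1) : (j <= k)%N -> tnth z j <= tnth z k.
  have [_ _ z_sorted] := z_zero.
  by rewrite !(tnth_nth 0) lt_sorted_leq_nth // inE size_tuple ltn_ord.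
have rcons_y j : tnth [tuple of rcons y 0] (widen_ord (leqnSn n) j) = tnth y j.
  by rewrite !(tnth_nth 0) /= nth_rcons size_tuple ltn_ord.
(* By interlacing, the [y_j] below [z_i] are exactly those with [j < i]. *)
have y_sign : 0 < (-1) ^+ (n - i) * (narayana_poly R n.+1).[tnth z i].
  apply: (sign_between_zeros _ _ _ _ y) => // [|j lt_ji|j le_ij].
  - by rewrite lead_coef_narayana_poly ltr01.
  - apply: lt_le_trans (z_le (lift ord0 j) i lt_ji).
    by rewrite -rcons_y; apply: zy0.2.
  - apply: le_lt_trans (z_le i (widen_ord (leqnSn n) j) le_ij) _.
    by rewrite -rcons_y; apply: zy0.1.
have root_z : (narayana_poly R n.+2).[tnth z i] = 0.
  by apply/rootP/real_simple_zeros_root.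
have /(congr1 (horner^~ (tnth z i))) := narayana_rec R n.+1 isT.
rewrite /= -polyC1.
rewrite !(hornerZ, horner_exp, hornerD, hornerN, hornerM, hornerC, hornerX).
rewrite root_z !mulr0 sub0r => rec.
have rec_gt0 : 0 < n.+1%:R + 3 :> R by rewrite addr_gt0 ?ltr0n.
(* The exponent grows by one with the degree; this extra sign cancels the minus of the
   recurrence. *)
rewrite subSn -1?ltnS // exprS -(pmulr_rgt0 _ rec_gt0) mulrCA rec.
have -> : forall s t u v : R, -1 * s * - (t * (u * v)) = t * (u * (s * v)).
  by move=> s t u v; ring.
apply: mulr_gt0; first by rewrite ltr0n.
apply: mulr_gt0 y_sign; rewrite exprn_gt0 // subr_gt0.
exact: lt_trans (z_lt0 i) ltr01.
Qed.


Theorem corollary3p3 (R : realType) (n : nat) (hn : (1 <= n)%N) :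
  [/\ ('X - 1%:P) %| narayana_numerator R n,
      size (narayana_tilde R n) = n
    & prec (narayana_tilde R n) (narayana_poly R n)].
Proof.
case: n hn => // m _.
have [y [y_zero y_lt0 y_alt]] := narayana_zeros R m.
have [_ y_fact y_sorted] := y_zero.
have root_y i : (narayana_poly R m.+1).[tnth y i] = 0.
  by apply/rootP/real_simple_zeros_root.
(* All zeros are negative, so [narayana_ratio] is a genuine quotient and the numerator vanishes at
   1. *)
have N1_neq0 : (narayana_poly R m.+1).[1] != 0.
  apply/negP; rewrite -rootE y_fact lead_coef_narayana_poly scale1r.
  rewrite root_prod_XsubC => /tnthP[i] /esym y1.
  by have := y_lt0 i; rewrite y1 ltr10.
have dvd1 : ('X - 1%:P) %| narayana_numerator R m.+1.
  rewrite dvdp_XsubCl rootE /narayana_numerator !hornerE.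
  by rewrite /narayana_ratio divfK // subrr.
(* The numerator thus keeps the size and leading coefficient of its first term. *)
have lt_size : (size (- (narayana_ratio R m.+1 *: narayana_poly R m.+1))
    < size (narayana_poly R m.+2))%N.
  rewrite size_polyN size_narayana_poly ltnS.
  by rewrite (leq_trans (size_scale_leq _ _)) // size_narayana_poly.
have size_tilde : size (narayana_tilde R m.+1) = m.+1.
  rewrite /narayana_tilde size_divp ?polyXsubC_eq0 // size_XsubC subn1.
  by rewrite /narayana_numerator size_polyDl // size_narayana_poly.
have tildeK := divpK dvd1.
split=> //; exists m.
have [||||x x_zero xy] := @interlaced_zeros R m (narayana_tilde R m.+1) y.
- exact: size_tilde.
- rewrite -[X in 0 < X]mulr1 -(lead_coefXsubC (1 : R)) -lead_coefM tildeK.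
  by rewrite /narayana_numerator lead_coefDl // lead_coef_narayana_poly.
- exact: y_sorted.
- move=> i; have := y_alt i.
  have /(congr1 (horner^~ (tnth y i))) := tildeK.
  rewrite /= -/(narayana_tilde R m.+1) !hornerE root_y mulr0 subr0 => <-.
  (* One sign is split off to turn the negative factor [y_i - 1] into [1 - y_i]. *)
  rewrite -(subnSK (ltn_ord i)) exprS.
  have -> : forall s t u : R, -1 * s * (t * (u - 1)) = (1 - u) * (s * t).
    by move=> s t u; ring.
  by rewrite pmulr_rgt0 // subr_gt0 (lt_trans (y_lt0 i)).
by exists x, y.
Qed.
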